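(* (1) Let $K$ be a two-dimensional local skew field whose residue skew field $K_1$ is commutative, and let $\alpha$ be its canonical automorphism. If $\alpha^n \neq \mathrm{id}$ for all integers $n \geq 1$, then $\mathrm{char}(K_2) = \mathrm{char}(K_1)$ (where $K_2 = K$), $K$ splits, and $K$ is isomorphic (as a two-dimensional local skew field) to the skew Laurent series field $K_1((t_2))$ in which $t_2 a = \alpha(a) t_2$ for all $a \in K_1$. (2) Let $K, K'$ be two-dimensional local skew fields whose residue skew fields $K_1, K'_1$ are commutative, with canonical automorphisms $\alpha, \alpha'$ respectively, and suppose $\alpha^n \neq \mathrm{id}$ and $\alpha'^n \neq \mathrm{id}$ for all $n \geq 1$. Then $K$ is isomorphic to $K'$ (as two-dimensional local skew fields) if and only if there is a field isomorphism $f : K_1 \to K'_1$ such that $\alpha = f^{-1}\alpha' f$.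
   Context: A skew field is a complete discrete valuation skew field if it is complete with respect to a discrete valuation (its residue skew field need not be commutative). A two-dimensional local skew field is a skew field $K = K_2$ such that $K_2$ is a complete discrete valuation skew field with residue skew field $K_1$, and $K_1$ is a complete discrete valuation skew field with residue skew field $K_0$. Write $\mathcal{O}_{K_2}, \mathcal{M}_{K_2}$ for the valuation ring and maximal ideal of $K_2$, similarly for $K_1$. $K$ splits if the residue homomorphism $\mathcal{O}_{K_2} \to K_1$ admits a ring-theoretic section. Canonical automorphism (when $K_1$ is commutative): for a prime element $t_2$ of $K_2$, the inner automorphism $y \mapsto t_2 y t_2^{-1}$ preserves $\mathcal{O}_{K_2}$ and $\mathcal{M}_{K_2}$ and hence induces an automorphism $\alpha$ of $K_1$; since $K_1$ is commutative this does not depend on the choice of $t_2$. Two two-dimensional local skew fields $K, K'$ are isomorphic if there is a ring isomorphism $K \to K'$ mapping $\mathcal{O}_K$ onto $\mathcal{O}_{K'}$, $\mathcal{M}_K$ onto $\mathcal{M}_{K'}$, and (on residue skew fields) $\mathcal{O}_{K_1}$ onto $\mathcal{O}_{K'_1}$, $\mathcal{M}_{K_1}$ onto $\mathcal{M}_{K'_1}$. For a field $K_1$ with automorphism $\alpha$, $K_1((t_2))$ denotes the skew field of formal Laurent series $\sum_{j \ge m} a_j t_2^j$ ($a_j \in K_1$) with multiplication determined by $t_2 a = \alpha(a) t_2$, with the $t_2$-adic valuation. *)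

(* Defs.v *)
From HB Require Import structures.
From mathcomp Require Import all_boot all_order all_algebra.
From Stdlib Require Import ClassicalEpsilon.
Set Implicit Arguments. Unset Strict Implicit. Unset Printing Implicit Defensive.
Import Order.TTheory GRing.Theory Num.Theory.
Local Open Scope ring_scope.

Section Valuations.
Variable R : unitRingType.

(* A skew field: every nonzero element is invertible (unitRingType is nontrivial). *)
Definition skew_field := forall x : R, x != 0 -> x \is a GRing.unit.

(* A (normalized) discrete valuation; v x is meaningful only for x <> 0,
   v 0 = +oo by convention (encoded by the disjunctions "x == 0 || ..."). *)
Record is_dval (v : R -> int) : Prop := {
  dval_mul : forall x y, x != 0 -> y != 0 -> v (x * y) = v x + v y;
  dval_add : forall x y, x != 0 -> y != 0 -> x + y != 0 ->
               Order.min (v x) (v y) <= v (x + y);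
  dval_surj : forall n : int, exists x, x != 0 /\ v x = n }.

Definition vring (v : R -> int) (x : R) : bool := (x == 0) || (0 <= v x).
Definition vmax (v : R -> int) (x : R) : bool := (x == 0) || (0 < v x).
Definition vsmall (v : R -> int) (N : int) (x : R) : bool := (x == 0) || (N <= v x).

Definition vcauchy (v : R -> int) (u : nat -> R) :=
  forall N : int, exists M : nat, forall m n, (M <= m)%N -> (M <= n)%N ->
    vsmall v N (u m - u n).
Definition vconverges (v : R -> int) (u : nat -> R) (l : R) :=
  forall N : int, exists M : nat, forall n, (M <= n)%N -> vsmall v N (u n - l).
Definition vcomplete (v : R -> int) :=
  forall u, vcauchy v u -> exists l, vconverges v u l.

Definition cdv_skew_field (v : R -> int) :=
  [/\ skew_field, is_dval v & vcomplete v].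

End Valuations.

(* res : R -> S is the residue homomorphism O_v -> S, i.e. S is (a copy of)
   the residue skew field O_v / M_v. *)
Record is_residue_map (R S : unitRingType) (v : R -> int) (res : R -> S) : Prop := {
  res_add : forall x y, vring v x -> vring v y -> res (x + y) = res x + res y;
  res_mul : forall x y, vring v x -> vring v y -> res (x * y) = res x * res y;
  res_one : res 1 = 1;
  res_surj : forall y, exists2 x, vring v x & res x = y;
  res_ker : forall x, vring v x -> (res x == 0) = vmax v x }.

(* K = K2 with valuation v2, residue skew field K1 (via res), K1 complete
   discrete valuation skew field with valuation v1 (its residue skew field
   K0 exists automatically). *)
Definition two_dim_local (K2 K1 : unitRingType) (v2 : K2 -> int)
  (res : K2 -> K1) (v1 : K1 -> int) :=
  [/\ cdv_skew_field v2, is_residue_map v2 res & cdv_skew_field v1].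

Definition canonical_aut (K2 K1 : unitRingType) (v2 : K2 -> int)
  (res : K2 -> K1) (alpha : K1 -> K1) :=
  forall t : K2, t != 0 -> v2 t = 1 ->
    forall y, vring v2 y -> alpha (res y) = res (t * y * t^-1).

Definition tdl_iso (K2 K1 : unitRingType) (v2 : K2 -> int) (res : K2 -> K1)
  (v1 : K1 -> int) (K2' K1' : unitRingType) (v2' : K2' -> int)
  (res' : K2' -> K1') (v1' : K1' -> int) :=
  exists phi : {rmorphism K2 -> K2'},
    [/\ bijective phi,
        forall x, vring v2' (phi x) = vring v2 x,
        forall x, vmax v2' (phi x) = vmax v2 x &
        exists g : K1 -> K1',
          [/\ forall x, vring v2 x -> g (res x) = res' (phi x),
              forall y, vring v1' (g y) = vring v1 y &
              forall y, vmax v1' (g y) = vmax v1 y]].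

Section SkewLaurent.
Variable K1 : unitRingType.
Variable alpha : K1 -> K1.

(* A series sum_{j >= m} a_j t2^j is represented by its coefficient
   function a : int -> K1, required to vanish below some index. *)
Definition lbounded (f : int -> K1) := exists m : int, forall j, j < m -> f j = 0.

Definition lbound (f : int -> K1) : int :=
  epsilon (inhabits 0) (fun m : int => forall j, j < m -> f j = 0).

Definition aut_inv (y : K1) : K1 := epsilon (inhabits y) (fun x => alpha x = y).
Definition autz (i : int) : K1 -> K1 :=
  match i with
  | Posz n => iter n alpha
  | Negz n => iter n.+1 aut_inv
  end.

Definition ls_add (f g : int -> K1) : int -> K1 := fun n => f n + g n.
Definition ls_one : int -> K1 := fun n => if n == 0 then 1 else 0.
(* (sum_i f_i t^i)(sum_j g_j t^j) = sum_n (sum_{i+j=n} f_i alpha^i(g_j)) t^n;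
   the index i ranges over [lbound f, n - lbound g]. *)
Definition ls_mul (f g : int -> K1) : int -> K1 := fun n =>
  \sum_(k < (absz (n - lbound f - lbound g)%R).+1)
     f (lbound f + k%:Z) * autz (lbound f + k%:Z) (g (n - (lbound f + k%:Z))).

End SkewLaurent.

(* K (with data v2, res, v1) is isomorphic, as a two-dimensional local skew
   field, to K1((t2)) with twist alpha, t2-adic valuation, residue field K1
   (coefficient of t2^0) carrying the valuation v1. *)
Definition iso_skew_laurent (K2 K1 : unitRingType) (v2 : K2 -> int)
  (res : K2 -> K1) (v1 : K1 -> int) (alpha : K1 -> K1) :=
  exists phi : (int -> K1) -> K2,
    (forall f g, lbounded f -> lbounded g -> phi f = phi g -> f = g) /\
    (forall x, exists2 f, lbounded f & phi f = x) /\
    (forall f g, lbounded f -> lbounded g -> phi (ls_add f g) = phi f + phi g) /\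
    (forall f g, lbounded f -> lbounded g ->
       phi (ls_mul alpha f g) = phi f * phi g) /\
    phi (@ls_one K1) = 1 /\
    (* phi maps O and M of the t2-adic valuation onto O_{K2}, M_{K2} *)
    (forall f, lbounded f -> (vring v2 (phi f) <-> forall j, j < 0 -> f j = 0)) /\
    (forall f, lbounded f -> (vmax v2 (phi f) <-> forall j, j <= 0 -> f j = 0)) /\
    (exists g : K1 -> K1,
       [/\ forall f, lbounded f -> (forall j, j < 0 -> f j = 0) ->
             res (phi f) = g (f 0),
           forall y, vring v1 (g y) = vring v1 y &
           forall y, vmax v1 (g y) = vmax v1 y]).

Definition splits (K2 K1 : unitRingType) (v2 : K2 -> int) (res : K2 -> K1) :=
  exists s : {rmorphism K1 -> K2}, forall a, vring v2 (s a) /\ res (s a) = a.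

Definition commutative_ring (R : unitRingType) := forall a b : R, a * b = b * a.

Definition aut_nontorsion (K1 : Type) (alpha : K1 -> K1) :=
  forall n : nat, (0 < n)%N -> ~ (forall a, iter n alpha a = a).

(* Main.v *)
Require Import Defs.
From HB Require Import structures.
From mathcomp Require Import all_boot all_order all_algebra.
From mathcomp Require Import zify.
From Stdlib Require Import ClassicalEpsilon FunctionalExtensionality.
Set Implicit Arguments. Unset Strict Implicit. Unset Printing Implicit Defensive.
Import Order.TTheory GRing.Theory Num.Theory.
Local Open Scope ring_scope.

(** By roots of 1-units, a complete discretely valued field carries only one
    discrete valuation, so alpha is an isometry and Baire's theorem gives a in
    K1 moved by every positive power of alpha. Let A lift a. On the graded
    piece t^n the map y |-> y A - A y is multiplication by alpha^n(a) - a, which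
    is nonzero for n >= 1; by completeness the map is a bijection of the maximal
    ideal, hence the centralizer of A in the valuation ring maps isomorphically
    onto K1. This is the section s. Solving y A - s(alpha a) y = c in the same
    way corrects a prime element to a t with t s(x) = s(alpha x) t for all x,
    and expansions in powers of t identify K with K1((t)). *)

(** * Arithmetic of a discrete valuation on a skew field *)

Section Valuation.
Variables (R : unitRingType) (v : R -> int).
Hypotheses (sfR : skew_field R) (vP : is_dval v).

Lemma skew_field_unit (x : R) : (x \is a GRing.unit) = (x != 0).
Proof. by apply/idP/idP => [|/sfR //]; apply: contraTneq => ->; rewrite unitr0. Qed.

Lemma skew_field_mul_neq0 (x y : R) : x != 0 -> y != 0 -> x * y != 0.
Proof. by rewrite -!skew_field_unit => ux uy; rewrite unitrMl. Qed.

Lemma dval1 : v 1 = 0.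
Proof.
by apply: (addrI (v 1)); rewrite addr0 -dval_mul ?oner_neq0 // mul1r.
Qed.

Lemma dvalN1 : v (- 1) = 0.
Proof.
have n1 : (- 1 : R) != 0 by rewrite oppr_eq0 oner_neq0.
by have := dval_mul vP n1 n1; rewrite mulrNN mul1r dval1; lia.
Qed.

Lemma dvalV x : x != 0 -> v x^-1 = - v x.
Proof.
move=> x0; have ux : x \is a GRing.unit by rewrite skew_field_unit.
have xV0 : x^-1 != 0 by rewrite -skew_field_unit unitrV.
by have := dval_mul vP x0 xV0; rewrite mulrV // dval1; lia.
Qed.

Lemma dvalX x (n : nat) : x != 0 -> x ^+ n != 0 /\ v (x ^+ n) = n%:Z * v x.
Proof.
move=> x0; elim: n => [|n [xn0 vxn]].
  by rewrite expr0 oner_neq0 dval1 mul0r.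
rewrite exprS; split; first exact: skew_field_mul_neq0.
by rewrite dval_mul // vxn; lia.
Qed.

Lemma dvalXz x (n : int) : x != 0 -> x ^ n != 0 /\ v (x ^ n) = n * v x.
Proof.
move=> x0; case: n => n; first exact: dvalX.
have [xn0 vxn] := dvalX n.+1 x0.
rewrite NegzE -exprnN; split; last by rewrite dvalV // vxn; lia.
by rewrite -skew_field_unit unitrV skew_field_unit.
Qed.

Lemma vsmallE N x : x != 0 -> vsmall v N x = (N <= v x).
Proof. by rewrite /vsmall; case: eqP. Qed.

Lemma vsmall0 N : vsmall v N 0.
Proof. by rewrite /vsmall eqxx. Qed.

Lemma vsmall_le M N x : M <= N -> vsmall v N x -> vsmall v M x.
Proof. by rewrite /vsmall; case: eqP => //= _; apply: le_trans. Qed.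

Lemma vsmallD N x y : vsmall v N x -> vsmall v N y -> vsmall v N (x + y).
Proof.
have [->|x0] := eqVneq x 0; first by rewrite add0r.
have [->|y0] := eqVneq y 0; first by rewrite addr0.
have [->|xy0] := eqVneq (x + y) 0; first by rewrite vsmall0.
rewrite !vsmallE // => Nx Ny; apply: le_trans (dval_add vP x0 y0 xy0).
by rewrite le_min Nx.
Qed.

Lemma vsmallM M N x y :
  vsmall v M x -> vsmall v N y -> vsmall v (M + N) (x * y).
Proof.
have [->|x0] := eqVneq x 0; first by rewrite mul0r !vsmall0.
have [->|y0] := eqVneq y 0; first by rewrite mulr0 !vsmall0.
rewrite !vsmallE ?skew_field_mul_neq0 // dval_mul //; exact: lerD.
Qed.

Lemma vring1 : vsmall v 0 1.
Proof. by rewrite vsmallE ?oner_neq0 // dval1. Qed.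

Lemma vsmallN N x : vsmall v N (- x) = vsmall v N x.
Proof.
suff H y : vsmall v N y -> vsmall v N (- y).
  by apply/idP/idP => /H //; rewrite opprK.
move=> Ny; rewrite -mulN1r -[N]add0r; apply: vsmallM => //.
by rewrite vsmallE ?oppr_eq0 ?oner_neq0 // dvalN1.
Qed.

Lemma vsmallB N x y : vsmall v N x -> vsmall v N y -> vsmall v N (x - y).
Proof. by move=> Nx Ny; apply: vsmallD; rewrite ?vsmallN. Qed.

Lemma vsmall_sum N (I : Type) (r : seq I) (P : pred I) (F : I -> R) :
  (forall i, P i -> vsmall v N (F i)) -> vsmall v N (\sum_(i <- r | P i) F i).
Proof. by move=> NF; elim/big_ind: _ => //; [exact: vsmall0|exact: vsmallD]. Qed.

Lemma vsmallXz x (n : int) : x != 0 -> v x = 1 -> vsmall v n (x ^ n).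
Proof. by move=> x0 vx; have [? e] := dvalXz n x0; rewrite vsmallE // e vx mulr1. Qed.

Lemma vsmall_divXz x y (n : int) :
  x != 0 -> v x = 1 -> vsmall v n y -> vsmall v 0 (y * x ^ - n).
Proof. by move=> x0 vx ny; rewrite -(subrr n); apply/vsmallM/vsmallXz. Qed.

Lemma vring_natr n : vsmall v 0 n%:R.
Proof.
elim: n => [|n IHn]; first by rewrite vsmall0.
by rewrite -natr1 vsmallD ?vring1.
Qed.

(** Separatedness of the filtration: identities can be checked to every order, counting from any
    starting order [m]. *)
Lemma vsmall_all_eq0 (m : int) x : (forall n : nat, vsmall v (m + n%:Z) x) -> x = 0.
Proof.
move=> H; apply/eqP/negPn/negP => x0.
by have := H (absz (v x - m + 1)); rewrite vsmallE //; lia.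
Qed.

Lemma vunit_inv x : x != 0 -> v x = 0 -> vsmall v 0 x^-1.
Proof.
move=> x0 vx; have xV0 : x^-1 != 0 by rewrite -skew_field_unit unitrV skew_field_unit.
by rewrite vsmallE // dvalV // vx.
Qed.

(** If [x] lay in the maximal ideal, so would [1 = x - (x - 1)], against [v 1 = 0]. *)
Lemma vunit1D x : vsmall v 1 (x - 1) -> x != 0 /\ v x = 0.
Proof.
move=> H; have x0 : x != 0.
  apply: contraTneq H => ->; rewrite sub0r vsmallN vsmallE ?oner_neq0 //.
  by rewrite dval1.
split=> //; apply/eqP; rewrite eq_le; apply/andP; split.
  rewrite leNgt; apply/negP => vx.
  have : vsmall v 1 1.
    by rewrite -[X in vsmall _ _ X](subKr x) vsmallB // vsmallE //; lia.
  by rewrite vsmallE ?oner_neq0 // dval1.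
have : vsmall v 0 x.
  by rewrite -(subrK 1 x) vsmallD ?vring1 // (vsmall_le _ H).
by rewrite vsmallE.
Qed.

(** * Limits, successive approximation and roots of 1-units *)

Hypothesis cR : vcomplete v.

(** By the ultrametric inequality all increments after step [n] add up to something within the bound
    at step [n], so the limit inherits the rate without loss. *)
Lemma fast_cauchy_lim (m : int) (u : nat -> R) :
  (forall n, vsmall v (m + n%:Z) (u n.+1 - u n)) ->
  exists l, forall n, vsmall v (m + n%:Z) (l - u n).
Proof.
move=> Hu.
have Huk n k : vsmall v (m + n%:Z) (u (n + k)%N - u n).
  elim: k => [|k IHk]; first by rewrite addn0 subrr vsmall0.
  rewrite addnS -(subrKA (u (n + k)%N)) vsmallD //.
  by apply: vsmall_le (Hu _); lia.
have [l ul] : exists l, vconverges v u l.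
  apply: cR => N; exists (absz (N - m)) => i j Mi Mj.
  rewrite -(subrKA (u (absz (N - m)))) -[u (absz (N - m)) - _]opprB vsmallB //.
    by rewrite -(subnKC Mi); apply: vsmall_le (Huk _ _); lia.
  by rewrite -(subnKC Mj); apply: vsmall_le (Huk _ _); lia.
exists l => n; have [M HM] := ul (m + n%:Z).
have Mn : (M <= n + M)%N by rewrite leq_addl.
by rewrite -(subrKA (u (n + M)%N)) vsmallD // -opprB vsmallN HM.
Qed.

(** [D] respects the filtration and is onto on each graded piece: solve one order at a time, feed
    the remainder back, and sum the corrections by completeness. *)
Lemma successive_approx (D : R -> R) (N : int) :
  {morph D : x y / x - y} ->
  (forall n y, N <= n -> vsmall v n y -> vsmall v n (D y)) ->
  (forall n z, N <= n -> vsmall v n z ->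
     exists y, vsmall v n y /\ vsmall v (n + 1) (z - D y)) ->
  forall z, vsmall v N z -> exists y, vsmall v N y /\ D y = z.
Proof.
move=> DB Dc Ds z Nz.
have D0 : D 0 = 0 by rewrite -[X in D X](subrr 0) DB subrr.
pose P n w y := vsmall v n y /\ vsmall v (n + 1) (w - D y).
pose g n w := epsilon (inhabits 0) (P n w).
have gP n w : N <= n -> vsmall v n w -> P n w (g n w).
  by move=> Nn nw; apply: epsilon_spec; apply: Ds.
pose fix y (k : nat) : R := if k is k'.+1 then
  y k' + g (N + k'%:Z) (z - D (y k')) else 0.
have zy k : vsmall v (N + k%:Z) (z - D (y k)).
  elim: k => [|k IHk] /=; first by rewrite D0 addr0 subr0.
  have [] := gP (N + k%:Z) (z - D (y k)) _ IHk; first by lia.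
  set d := g _ _ => _ Hd; have -> : N + k.+1%:Z = N + k%:Z + 1 by lia.
  suff -> : D (y k + d) = D (y k) + D d by rewrite opprD addrA.
  by rewrite -[d in LHS]opprK DB -[- d]sub0r DB D0 sub0r opprK.
have [|l Hl] := fast_cauchy_lim (m := N) (u := y).
  move=> k /=; rewrite [X in vsmall _ _ X]addrC addKr.
  by have [] := gP (N + k%:Z) (z - D (y k)) _ (zy k); first lia.
exists l; split; first by have := Hl 0%N; rewrite addr0 subr0.
apply/esym/eqP; rewrite -subr_eq0; apply/eqP/(vsmall_all_eq0 (m := N)) => k.
rewrite -(subrKA (D (y k))) vsmallD // -opprB vsmallN -DB Dc //; lia.
Qed.

(* Newton's method with the slope frozen at its residue: the error shrinks by at least one order at each step. *)
Lemma one_unit_root (n : nat) (u : R) : commutative_ring R ->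
  n%:R != 0 :> R -> v n%:R = 0 -> vsmall v 1 (u - 1) ->
  exists2 y, y != 0 & y ^+ n = u.
Proof.
move=> mulC n0 vn Hu; pose w : R := n%:R^-1.
have w0 : vsmall v 0 w by exact: vunit_inv.
have wn : w * n%:R = 1 by rewrite mulVr ?skew_field_unit.
pose fix y (k : nat) : R := if k is k'.+1 then y k' + (u - y k' ^+ n) * w else 1.
have M1 a b : vsmall v 1 (a - 1) -> vsmall v 1 (b - 1) -> vsmall v 1 (a * b - 1).
  move=> Ha Hb; rewrite -(subrKA b) vsmallD // -[X in _ - X]mul1r -mulrBl.
  rewrite -[1]addr0; apply: vsmallM => //.
  by rewrite -(subrK 1 b) vsmallD ?vring1 // (vsmall_le _ Hb).
have X1 a k : vsmall v 1 (a - 1) -> vsmall v 1 (a ^+ k - 1).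
  move=> Ha; elim: k => [|k IHk]; first by rewrite expr0 subrr vsmall0.
  by rewrite exprS M1.
(* The cofactor [S] of [a - b] is a sum of [n] products of 1-units, hence congruent to [n%:R]. *)
have XB a b : vsmall v 1 (a - 1) -> vsmall v 1 (b - 1) ->
    exists2 S, vsmall v 1 (S - n%:R) & a ^+ n - b ^+ n = (a - b) * S.
  move=> Ha Hb; rewrite subrXX_comm; last exact: mulC.
  eexists; last by [].
  rewrite -[X in _ - X%:R]card_ord -sumr_const -sumrB.
  by apply: vsmall_sum => i _; rewrite M1 ?X1.
have yP k : vsmall v 1 (y k - 1) /\ vsmall v (1 + k%:Z) (u - y k ^+ n).
  elim: k => [|k [IH1 IH2]] /=; first by rewrite expr1n subrr vsmall0.
  set d := _ * w; have dk : vsmall v (1 + k%:Z) d.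
    by rewrite -[1 + k%:Z]addr0; apply: vsmallM.
  have y1 : vsmall v 1 (y k + d - 1).
    by rewrite addrAC vsmallD // (vsmall_le _ dk); lia.
  split=> //; have [S HS E] := XB _ _ y1 IH1.
  (* The new error is [d * (n%:R - S)], whose factors have orders at least [1 + k] and 1. *)
  rewrite -(subrKA (y k ^+ n)) -[_ - (_ + d) ^+ n]opprB E [y k + d]addrC addrK.
  have -> : u - y k ^+ n = d * n%:R by rewrite -mulrA wn mulr1.
  rewrite -mulrBr -opprB mulrN vsmallN.
  have -> : 1 + k.+1%:Z = 1 + k%:Z + 1 by lia.
  exact: vsmallM.
have [|l Hl] := fast_cauchy_lim (m := 1) (u := y).
  move=> k /=; rewrite [X in vsmall _ _ X]addrC addKr -[1 + _]addr0; apply: vsmallM => //.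
  by have [] := yP k.
have l1 : vsmall v 1 (l - 1) by have := Hl 0%N; rewrite addr0.
exists l; first by have [] := vunit1D l1.
apply/esym/eqP; rewrite -subr_eq0; apply/eqP/(vsmall_all_eq0 (m := 1)) => k.
have [yk1 yk2] := yP k.
rewrite -(subrKA (y k ^+ n)) vsmallD // -opprB vsmallN.
have [S HS ->] := XB _ _ l1 yk1.
rewrite -[1 + _]addr0; apply: vsmallM => //.
by rewrite -(subrK n%:R S) vsmallD ?vring_natr // (vsmall_le _ HS).
Qed.

End Valuation.

(** * Uniqueness of the discrete valuation on a complete field *)

Section Comparison.
Variables (R : unitRingType) (v w : R -> int).
Hypotheses (sfR : skew_field R) (vP : is_dval v) (wP : is_dval w).

(** A [v]-unit and its inverse both lie in the ring of [w], so [w] vanishes on [v]-units and is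
    [w p] times [v] for a [v]-prime [p]. Surjectivity of [w] forces [w p] to be 1 or -1, and the
    inclusion of rings fixes the sign. *)
Lemma dval_eq_of_vring_sub :
  (forall x, vsmall v 0 x -> vsmall w 0 x) -> forall x, x != 0 -> w x = v x.
Proof.
move=> vw.
have v0w0 x : x != 0 -> v x = 0 -> w x = 0.
  move=> x0 vx; have xV0 : x^-1 != 0 by rewrite -skew_field_unit ?unitrV ?skew_field_unit.
  have := vw x; have := vw x^-1.
  by rewrite !vsmallE // (dvalV sfR vP) // (dvalV sfR wP) // vx; lia.
have [p [p0 vp]] := dval_surj vP 1.
have E x : x != 0 -> w x = v x * w p.
  move=> x0; have [pn0 vpn] := dvalXz sfR vP (- v x) p0.
  have [_ wpn] := dvalXz sfR wP (- v x) p0.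
  have := v0w0 _ (skew_field_mul_neq0 sfR x0 pn0).
  by rewrite (dval_mul vP) // (dval_mul wP) // vpn vp wpn; lia.
have [z [z0 wz]] := dval_surj wP 1.
have wp : 0 <= w p.
  by have := vw p; rewrite !vsmallE // vp; apply.
move=> x x0; rewrite (E x x0); move: wz; rewrite (E z z0).
move=> /(congr1 absz); rewrite abszM => /eqP; rewrite muln_eq1 => /andP[_ /eqP wp1].
have -> : w p = 1 by lia.
by rewrite mulr1.
Qed.

(* A 1-unit for v has n-th roots for infinitely many n, hence w-value divisible by all of them. *)
Lemma one_unit_dval (u : R) : vcomplete v -> commutative_ring R ->
  vsmall v 1 (u - 1) -> w u = 0.
Proof.
move=> cv mulC Hu.
(* From [y ^+ n = u], [w u] is a multiple of [n]; being smaller than [n] in absolute value, it is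
   zero. *)
suff [n [y [y0 wn yn]]] : exists n y, [/\ y != 0, (absz (w u) < n)%N & y ^+ n = u].
  have [_] := dvalX sfR wP n y0; rewrite yn => /(congr1 absz).
  by rewrite abszM; move: wn; case: (absz (w y)) => [|k]; nia.
have root n : (absz (w u) < n)%N -> ~~ vsmall v 1 n%:R ->
    exists n y, [/\ y != 0, (absz (w u) < n)%N & y ^+ n = u].
  move=> wn n1; have n0 : n%:R != 0 :> R by apply: contraNneq n1 => ->; rewrite vsmall0.
  have [|y y0 yn] := one_unit_root sfR vP cv mulC n0 _ Hu; last by exists n, y.
  by have := vring_natr vP n; move: n1; rewrite !vsmallE //; lia.
(* [n] and [n.+1] differ by 1, so they cannot both lie in the maximal ideal: one of them is an
   admissible exponent, whatever the residue characteristic. *)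
pose n := (absz (w u)).+1.
have [n1|] := boolP (vsmall v 1 (n%:R : R)); last by apply: root.
apply: (root n.+1) => //; apply/negP => n2.
have : vsmall v 1 (1 : R).
  have -> : 1 = n.+1%:R - n%:R :> R by rewrite -natr1 addrAC subrr add0r.
  exact: vsmallB.
by rewrite vsmallE ?oner_neq0 // (dval1 vP).
Qed.

(** For [x] in the maximal ideal of [v], [1 + x] is a 1-unit, so [w] vanishes on it and
    [x = (1 + x) - 1] has nonnegative [w]-value. High powers extend this to [v]-units, and the
    comparison of rings concludes. *)
Theorem cdv_unique : vcomplete v -> commutative_ring R ->
  forall x, x != 0 -> w x = v x.
Proof.
move=> cv mulC.
have max_ring x : x != 0 -> 0 < v x -> 0 <= w x.
  move=> x0 vx; have Hx : vsmall v 1 (1 + x - 1).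
    by rewrite addrAC subrr add0r vsmallE.
  have n0 : (- 1 : R) != 0 by rewrite oppr_eq0 oner_neq0.
  have [xu _] := vunit1D sfR vP Hx.
  have := dval_add wP xu n0; rewrite (one_unit_dval cv mulC Hx) (dvalN1 wP) minxx.
  by rewrite addrAC subrr add0r; apply.
apply: dval_eq_of_vring_sub => x.
have [->|x0] := eqVneq x 0; first by rewrite !vsmall0.
rewrite !vsmallE // => vx; have [/max_ring|vx0] := ltP 0 (v x); first exact.
rewrite leNgt; apply/negP => wx.
have [p [p0 vp]] := dval_surj vP 1.
(* Here [v x = 0] and [w x < 0]. With this exponent, the power of [x] times [p] has [v]-value 1 but
   negative [w]-value. *)
have [xk vxk] := dvalX sfR vP (absz (w p)).+1 x0.
have [_ wxk] := dvalX sfR wP (absz (w p)).+1 x0.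
have := max_ring _ (skew_field_mul_neq0 sfR xk p0).
rewrite (dval_mul vP) // (dval_mul wP) // vxk wxk; nia.
Qed.

End Comparison.

(** Pulling back along an isomorphism produces a second valuation on the source, to be compared with
    the given one. *)
Lemma dval_comp (R S : unitRingType) (w : S -> int) (f : {rmorphism R -> S}) :
  is_dval w -> injective f -> (forall y, exists x, f x = y) ->
  is_dval (w \o f).
Proof.
move=> wP fI fS.
have f0 x : x != 0 -> f x != 0.
  by apply: contra_neq => fx; apply: fI; rewrite fx rmorph0.
split=> [x y x0 y0|x y x0 y0 xy0|n] /=.
- by rewrite rmorphM (dval_mul wP) ?f0.
- by rewrite rmorphD (dval_add wP) ?f0 // -rmorphD f0.
- have [y [y0 wy]] := dval_surj wP n; have [x fx] := fS y.
  exists x; rewrite fx; split=> //.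
  by apply: contra_neq y0 => x0; rewrite -fx x0 rmorph0.
Qed.

(** * An element moved by every positive power of an isometric automorphism *)

Section Aperiodic.
Variables (F : unitRingType) (v : F -> int) (al : {rmorphism F -> F}).
Hypotheses (sfF : skew_field F) (vP : is_dval v) (cF : vcomplete v).
Hypotheses (al_iso : forall x, x != 0 -> v (al x) = v x) (alNt : aut_nontorsion al).

Lemma iter_rmorphB n x y : iter n al (x - y) = iter n al x - iter n al y.
Proof. by elim: n => //= n ->; rewrite rmorphB. Qed.

Lemma iter_rmorphM n x y : iter n al (x * y) = iter n al x * iter n al y.
Proof. by elim: n => //= n ->; rewrite rmorphM. Qed.

Lemma iter_rmorph0 n : iter n al 0 = 0.
Proof. by elim: n => //= n ->; rewrite rmorph0. Qed.

Lemma vsmall_iter n N x : vsmall v N x -> vsmall v N (iter n al x).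
Proof.
elim: n => //= n IHn /IHn; have [->|y0] := eqVneq (iter n al x) 0.
  by rewrite rmorph0.
rewrite vsmallE // => Ny; have [->|y1] := eqVneq (al (iter n al x)) 0.
  exact: vsmall0.
by rewrite vsmallE // al_iso.
Qed.

(* A fixed field containing a ball around 0 contains all quotients of its elements, hence all of F. *)
Lemma exists_small_moved n N : (0 < n)%N ->
  exists b, vsmall v N b /\ iter n al b <> b.
Proof.
move=> n0; case: (excluded_middle_informative (exists b, vsmall v N b /\ iter n al b <> b)) => // H.
have fixN b : vsmall v N b -> iter n al b = b.
  by move=> Nb; apply: NNPP => nb; case: H; exists b.
case: (alNt n0) => y; have [p [p0 vp]] := dval_surj vP 1.
have [->|y0] := eqVneq y 0; first exact: iter_rmorph0.
(* This [k] puts both [p ^ k] and [y * p ^ k] into the ball, so [y] is a quotient of fixed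
   elements. *)
pose k := Order.max N (N - v y).
have [pk0 vpk] := dvalXz sfF vP k p0.
have pkN : iter n al (p ^ k) = p ^ k.
  by apply: fixN; rewrite vsmallE // vpk vp; lia.
apply: (mulIr (sfF pk0)); rewrite -[X in _ * X = _]pkN -iter_rmorphM.
apply: fixN; rewrite vsmallE ?skew_field_mul_neq0 // (dval_mul vP) // vpk vp; lia.
Qed.

(* Baire category argument: the fixed fields of the iterates of al cannot exhaust F. *)
Lemma exists_aperiodic : exists a, forall n, (0 < n)%N -> iter n al a <> a.
Proof.
pose mv k x := iter k.+1 al x - x.
(* A state is a centre with a radius exponent. Step [k] picks, inside the previous ball, a centre
   displaced by the [k.+1]-st iterate, and a ball smaller than that displacement. *)
pose P k (s s' : F * int) :=
  [/\ vsmall v s.2 (s'.1 - s.1), mv k s'.1 != 0, s.2 < s'.2 & v (mv k s'.1) < s'.2].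
have Pex k s : exists s', P k s s'.
  suff [b [Nb bP]] : exists b, vsmall v s.2 b /\ mv k (s.1 + b) != 0.
    exists (s.1 + b, Order.max s.2 (v (mv k (s.1 + b))) + 1).
    by split=> //=; [rewrite [X in vsmall _ _ X]addrC addKr | lia | lia].
  have [k0|] := eqVneq (mv k s.1) 0; last first.
    by exists 0; rewrite vsmall0 addr0.
  have [b [Nb bP]] := exists_small_moved s.2 (ltn0Sn k).
  exists b; split=> //; have -> : mv k (s.1 + b) = mv k s.1 + mv k b.
    rewrite /mv -[b in LHS]opprK iter_rmorphB -[- b]sub0r iter_rmorphB.
    by rewrite iter_rmorph0 !sub0r !opprK opprD addrACA.
  by rewrite k0 add0r subr_eq0; apply/eqP.
pose st := fix st k : F * int := if k is k'.+1 then
  epsilon (inhabits (0, 0)) (P k' (st k')) else (0, 0).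
have stP k : P k (st k) (st k.+1) by apply: epsilon_spec; apply: Pex.
have stN k j : (st k).2 + j%:Z <= (st (k + j)%N).2.
  elim: j => [|j IHj]; first by rewrite addn0; lia.
  by rewrite addnS; have [_ _ + _] := stP (k + j)%N; lia.
have stk k j : vsmall v (st k).2 ((st (k + j)%N).1 - (st k).1).
  elim: j => [|j IHj]; first by rewrite addn0 subrr vsmall0.
  rewrite addnS -(subrKA (st (k + j)%N).1) vsmallD //.
  have [+ _ _ _] := stP (k + j)%N; apply: vsmall_le.
  by have := stN k j; lia.
have [|a aP] := fast_cauchy_lim sfF vP cF (m := 0) (u := fun k => (st k).1).
  move=> k; have [+ _ _ _] := stP k; apply: vsmall_le.
  exact: (stN 0%N k).
have aN k : vsmall v (st k).2 (a - (st k).1).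
  (* [a] agrees with the [n]-th centre to order [n], so going [j] steps further reaches the order
     [(st k).2]. *)
  pose j := absz (st k).2.
  rewrite -(subrKA (st (k + j)%N).1) vsmallD //.
  by apply: vsmall_le (aP _); lia.
exists a => -[//|k] _ ak; have [_ mk _ vk] := stP k.
(* If the iterate fixed [a], the displacement of the centre would be [d] minus its image, hence as
   small as the radius, against the last clause of [P]. *)
have := aN k.+1; set d := a - _ => dN.
have : mv k (st k.+1).1 = d - iter k.+1 al d.
  rewrite [X in _ - X]iter_rmorphB ak /mv /d.
  by rewrite opprB [RHS]addrC subrKA.
move=> E; have := vsmallB sfF vP dN (vsmall_iter k.+1 dN).
by rewrite -E vsmallE //; lia.
Qed.

End Aperiodic.

Lemma exists_rmorphism (R S : unitRingType) (f : R -> S) :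
  {morph f : x y / x - y} -> f 1 = 1 -> {morph f : x y / x * y} ->
  exists g : {rmorphism R -> S}, g = f :> (R -> S).
Proof.
move=> fB f1 fM.
pose Za := GRing.isZmodMorphism.Build R S f fB.
pose Ma := GRing.isMonoidMorphism.Build R S f (f1, fM).
pose g : {rmorphism R -> S} := HB.pack f Za Ma.
by exists g.
Qed.

(** * The residue homomorphism and the canonical automorphism *)

Section Residue.
Variables (K K1 : unitRingType) (v : K -> int) (res : K -> K1).
Hypotheses (sfK : skew_field K) (vP : is_dval v) (resP : is_residue_map v res).

Lemma residue0 : res 0 = 0.
Proof.
by apply: (addrI (res 0)); rewrite -(res_add resP) ?addr0 //; apply: vsmall0.
Qed.

Lemma residueN x : vsmall v 0 x -> res (- x) = - res x.
Proof.
move=> Hx; apply: (addrI (res x)); rewrite -(res_add resP) ?subrr ?residue0 //.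
by rewrite [vring _ _]vsmallN.
Qed.

Lemma residueB x y : vsmall v 0 x -> vsmall v 0 y -> res (x - y) = res x - res y.
Proof.
by move=> Hx Hy; rewrite (res_add resP) ?residueN // [vring _ _]vsmallN.
Qed.

Lemma residueM x y : vsmall v 0 x -> vsmall v 0 y -> res (x * y) = res x * res y.
Proof. exact: (res_mul resP). Qed.

Lemma residue_eq0 x : vsmall v 0 x -> (res x == 0) = vsmall v 1 x.
Proof. exact: (res_ker resP). Qed.

Lemma vsmall_residue_eq x y : vsmall v 0 x -> vsmall v 0 y ->
  res x = res y -> vsmall v 1 (x - y).
Proof.
by move=> Hx Hy E; rewrite -residue_eq0 ?residueB ?E ?subrr ?vsmallB.
Qed.

Lemma vringM x y : vsmall v 0 x -> vsmall v 0 y -> vsmall v 0 (x * y).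
Proof. by move=> Hx Hy; rewrite -[0]addr0; apply: vsmallM. Qed.

Lemma vsmallJ u N x : u != 0 -> vsmall v N (u * x * u^-1) = vsmall v N x.
Proof.
move=> u0; have uu : u \is a GRing.unit by rewrite skew_field_unit.
have uV0 : u^-1 != 0 by rewrite -skew_field_unit // unitrV.
have [->|x0] := eqVneq x 0; first by rewrite mulr0 mul0r.
rewrite !vsmallE ?skew_field_mul_neq0 // (dval_mul vP) ?skew_field_mul_neq0 //.
rewrite (dval_mul vP) // (dvalV sfK vP) //; lia.
Qed.

Lemma vsmall_mulX t M n y : t != 0 -> v t = 1 ->
  vsmall v M y -> vsmall v (M + n%:Z) (y * t ^+ n).
Proof.
move=> t0 vt My; have [tn0 vtn] := dvalX sfK vP n t0.
by apply: vsmallM => //; rewrite vsmallE // vtn vt; lia.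
Qed.

Lemma vsmall_divX t n y : t != 0 -> v t = 1 ->
  vsmall v n%:Z y -> vsmall v 0 (y * t ^- n).
Proof.
move=> t0 vt ny; have [tn0 vtn] := dvalX sfK vP n t0.
rewrite -(subrr n%:Z); apply: vsmallM => //.
have tV0 : t ^- n != 0 by rewrite -skew_field_unit // unitrV skew_field_unit.
by rewrite vsmallE // (dvalV sfK vP) // vtn vt; lia.
Qed.

Variable alpha : K1 -> K1.
Hypothesis alphaP : canonical_aut v res alpha.

(** On residues [alpha] is induced by conjugation by a prime [t], which is multiplicative, additive
    and preserves the valuation ring. *)
Lemma canonical_aut_rmorphism :
  exists al : {rmorphism K1 -> K1}, al = alpha :> (K1 -> K1).
Proof.
have [t [t0 vt]] := dval_surj vP 1.
have ut : t \is a GRing.unit by rewrite skew_field_unit.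
have Jt N x : vsmall v N x -> vsmall v N (t * x * t^-1) by rewrite vsmallJ.
apply: exists_rmorphism.
- move=> x y; have [x' Hx <-] := res_surj resP x; have [y' Hy <-] := res_surj resP y.
  rewrite -residueB // !(alphaP t0 vt) //; last exact: vsmallB.
  by rewrite mulrBr mulrBl residueB ?Jt.
- rewrite -(res_one resP) (alphaP t0 vt) ?mulr1 ?mulrV //; exact: vring1.
move=> x y; have [x' Hx <-] := res_surj resP x; have [y' Hy <-] := res_surj resP y.
rewrite -residueM // !(alphaP t0 vt) //; last exact: vringM.
by rewrite -residueM ?Jt // !mulrA mulrVK.
Qed.

Lemma canonical_aut_inj : injective alpha.
Proof.
have [al alE] := canonical_aut_rmorphism.
have [t [t0 vt]] := dval_surj vP 1.
move=> x y xy; apply/eqP; rewrite -subr_eq0; apply/eqP.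
have : alpha (x - y) = 0 by rewrite -alE rmorphB /= alE xy subrr.
have [z Hz <-] := res_surj resP (x - y).
rewrite (alphaP t0 vt) // => /eqP; rewrite residue_eq0 ?vsmallJ //.
by rewrite -residue_eq0 // => /eqP.
Qed.

Lemma canonical_aut_surj y : exists x, alpha x = y.
Proof.
have [t [t0 vt]] := dval_surj vP 1.
have ut : t \is a GRing.unit by rewrite skew_field_unit.
have tV0 : t^-1 != 0 by rewrite -skew_field_unit ?unitrV.
have [z Hz <-] := res_surj resP y; exists (res (t^-1 * z * t)).
rewrite (alphaP t0 vt); last by rewrite -[X in _ * X]invrK [vring _ _]vsmallJ.
by rewrite !mulrA mulrV // mul1r mulrK.
Qed.

Lemma iter_canonical_aut t n x : t != 0 -> v t = 1 -> vsmall v 0 x ->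
  iter n alpha (res x) = res (t ^+ n * x * t ^- n).
Proof.
move=> t0 vt Hx; have ut : t \is a GRing.unit by rewrite skew_field_unit.
elim: n => [|n IHn]; first by rewrite expr0 invr1 mulr1 mul1r.
have [tn0 _] := dvalX sfK vP n t0.
rewrite iterS IHn (alphaP t0 vt); last by rewrite [vring _ _]vsmallJ.
by rewrite [in RHS]exprS invrM ?unitrX // !mulrA.
Qed.

Hypotheses (cK : vcomplete v) (sfK1 : skew_field K1) (mulC : commutative_ring K1).

(** * Twisted commutators and the equivariant section *)

Section TwistedCommutator.
Variables (P Q : K) (N : nat).
Hypotheses (HP : vsmall v 0 P) (HQ : vsmall v 0 Q).
Hypothesis PQ : forall n, (N <= n)%N -> iter n alpha (res P) <> res Q.

(* On the t^n-graded piece, y |-> y P - Q y is multiplication by the nonzero scalar alpha^n(res P) - res Q. *)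
Lemma twisted_commutator_surj z : vsmall v N%:Z z ->
  exists y, vsmall v N%:Z y /\ y * P - Q * y = z.
Proof.
have [t [t0 vt]] := dval_surj vP 1.
apply: (successive_approx sfK vP cK (D := fun y => y * P - Q * y)).
- by move=> x y; rewrite mulrBl mulrBr opprD addrACA -opprD.
- move=> n y _ ny; apply: vsmallB => //.
    by rewrite -[n]addr0; apply: vsmallM.
  by rewrite -[n]add0r; apply: vsmallM.
move=> n {}z Nn; have -> : n = (absz n)%:Z by lia.
have {Nn} : (N <= absz n)%N by lia.
move: (absz n) => k Nk kz; have [T0 _] := dvalX sfK vP k t0.
have uT : t ^+ k \is a GRing.unit by rewrite skew_field_unit.
have Hz0 := vsmall_divX t0 vt kz; set z0 := z * _ in Hz0.
pose c := iter k alpha (res P) - res Q.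
have c0 : c \is a GRing.unit.
  by rewrite skew_field_unit // subr_eq0; apply/eqP/PQ.
(* [y0] lifts the solution on the graded piece. Moving [t ^+ k] across [P] replaces it by [P'],
   whose residue is [iter k alpha (res P)]. *)
have [y0 Hy0 y0E] := res_surj resP (res z0 * c^-1).
exists (y0 * t ^+ k); split; first by rewrite -[k%:Z]add0r; apply: vsmall_mulX.
pose P' := t ^+ k * P * t ^- k.
have HP' : vsmall v 0 P' by rewrite vsmallJ.
have -> : z - (y0 * t ^+ k * P - Q * (y0 * t ^+ k)) =
    (z0 - (y0 * P' - Q * y0)) * t ^+ k.
  by rewrite !mulrBl mulrVK // /P' !mulrA mulrVK.
rewrite addrC; apply: vsmall_mulX => //.
have P'E : res P' = iter k alpha (res P) by rewrite -iter_canonical_aut.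
have HyP : vsmall v 0 (y0 * P') by apply: vringM.
have HQy : vsmall v 0 (Q * y0) by apply: vringM.
have Hyy : vsmall v 0 (y0 * P' - Q * y0) by apply: vsmallB.
rewrite -residue_eq0; last exact: vsmallB.
rewrite 2?residueB // (residueM Hy0 HP') (residueM HQ Hy0) P'E y0E.
by rewrite [res Q * _]mulC -mulrBr -/c mulrVK // subrr.
Qed.

(** Write [y = x * t ^+ k] with [x] a unit of the valuation ring: its nonzero residue would be
    killed by the nonzero scalar [iter k alpha (res P) - res Q]. *)
Lemma twisted_commutator_inj y : vsmall v N%:Z y -> y * P = Q * y -> y = 0.
Proof.
have [t [t0 vt]] := dval_surj vP 1.
move=> Ny E; apply/eqP/negPn/negP => y0; move: Ny; rewrite vsmallE // => Ny.
have : vsmall v (absz (v y))%:Z y by rewrite vsmallE //; lia.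
have {Ny} : (N <= absz (v y))%N by lia.
have vy : v y <= (absz (v y))%:Z by lia.
move: (absz (v y)) vy => k vy Nk ky; have [T0 vT] := dvalX sfK vP k t0.
have uT : t ^+ k \is a GRing.unit by rewrite skew_field_unit.
have Hx := vsmall_divX t0 vt ky; set x := y * _ in Hx.
have xE : y = x * t ^+ k by rewrite mulrVK.
have x0 : x != 0 by apply: contraNneq y0 => x0; rewrite xE x0 mul0r.
pose P' := t ^+ k * P * t ^- k.
have HP' : vsmall v 0 P' by rewrite vsmallJ.
have E' : x * P' = Q * x by rewrite /P' /x !mulrA mulrVK // E.
have : res x * (iter k alpha (res P) - res Q) = 0.
  rewrite (iter_canonical_aut _ t0 vt) // mulrBr -!residueM //.
  by rewrite E' residueM // mulC -residueM // subrr.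
apply/eqP/skew_field_mul_neq0 => //; last by rewrite subr_eq0; apply/eqP/PQ.
rewrite residue_eq0 // vsmallE //; apply/negP => vx.
by move: vy; rewrite {1}xE (dval_mul vP) // vT vt; lia.
Qed.

End TwistedCommutator.

(* The section is the inverse of the residue map on the centralizer of a lift A of a; t is chosen so that t A t^-1 lies in that centralizer. *)
Lemma exists_equivariant_section :
  (exists a, forall n, (0 < n)%N -> iter n alpha a <> a) ->
  exists (s : {rmorphism K1 -> K}) (t : K),
    [/\ forall x, vsmall v 0 (s x) /\ res (s x) = x, t != 0, v t = 1 &
        forall x, t * s x = s (alpha x) * t].
Proof.
move=> [a aP]; have [A HA Aa] := res_surj resP a.
have centr_inj B y : vsmall v 0 B ->
    (forall n, (0 < n)%N -> iter n alpha (res B) <> res B) ->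
    vsmall v 1 y -> y * B = B * y -> y = 0.
  by move=> HB BP; apply: (twisted_commutator_inj (N := 1)).
have AP n : (0 < n)%N -> iter n alpha (res A) <> res A by rewrite Aa; apply: aP.
pose S x y := [/\ vsmall v 0 y, res y = x & y * A = A * y].
have Sex x : exists y, S x y.
  have [x' Hx' x'E] := res_surj resP x.
  (* Commutativity of [K1] puts this commutator in the maximal ideal, so it is also the commutator
     of some [y] there; [x' - y] keeps the residue and commutes with [A]. *)
  have : vsmall v 1%:Z (x' * A - A * x').
    rewrite -residue_eq0 ?vsmallB ?vringM // residueB ?vringM // !residueM //.
    by rewrite mulC subrr.
  case/(twisted_commutator_surj HA HA AP) => y [Hy yE].
  have Hy0 : vsmall v 0 y by apply: vsmall_le Hy.
  exists (x' - y); split; first exact: vsmallB.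
    by rewrite residueB // x'E (eqP (_ : res y == 0)) ?residue_eq0 ?subr0.
  apply/eqP; rewrite -subr_eq0 mulrBl mulrBr opprD addrACA -opprD.
  by rewrite yE subrr.
have Suniq x y y' : S x y -> S x y' -> y = y'.
  move=> [H0 HE HC] [H0' HE' HC']; apply/eqP; rewrite -subr_eq0; apply/eqP.
  apply: (centr_inj A) => //; first by apply: vsmall_residue_eq; rewrite ?HE.
  by rewrite mulrBl mulrBr HC HC'.
pose s x := epsilon (inhabits 0) (S x).
have sP x : S x (s x) by apply: epsilon_spec.
have [] := @exists_rmorphism K1 K s.
- move=> x y; apply: Suniq (sP _) _.
  have [Hx xE xC] := sP x; have [Hy yE yC] := sP y.
  by split; rewrite ?vsmallB ?residueB ?xE ?yE // mulrBl mulrBr xC yC.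
- apply: Suniq (sP _) _; split; rewrite ?vring1 ?(res_one resP) //.
  by rewrite mul1r mulr1.
- move=> x y; apply: Suniq (sP _) _.
  have [Hx xE xC] := sP x; have [Hy yE yC] := sP y.
  by split; rewrite ?vringM ?residueM ?xE ?yE // -mulrA yC mulrA xC mulrA.
move=> sm sE; exists sm.
have [t1 [t10 vt1]] := dval_surj vP 1.
have ut1 : t1 \is a GRing.unit by rewrite skew_field_unit.
have [HB BE _] := sP (alpha a); set B := s _ in HB BE.
have iterS' n x : iter n alpha (alpha x) = alpha (iter n alpha x).
  by rewrite -iterSr iterS.
have BP n : (0 < n)%N -> iter n alpha (res B) <> res B.
  by move=> n0; rewrite BE iterS' => /canonical_aut_inj; apply: aP.
(* [t1 * A * t1^-1] and [B] share the residue [alpha a], and the factor [t1] adds one order.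
   Starting at order 2 avoids the exponent 1, where [alpha a = res B] makes the scalar vanish, and
   keeps [t1 - y] prime. *)
have H1 : vsmall v 2%:Z (t1 * A - B * t1).
  have -> : t1 * A - B * t1 = (t1 * A * t1^-1 - B) * t1 by rewrite mulrBl mulrVK.
  apply: (vsmallM sfK vP (M := 1) (N := 1)); last by rewrite vsmallE // vt1.
  apply: vsmall_residue_eq; rewrite ?vsmallJ //.
  by rewrite -(alphaP t10 vt1) // Aa BE.
have [] := twisted_commutator_surj HA HB (N := 2) _ H1.
  move=> [//|n] n1; rewrite Aa BE iterS => /canonical_aut_inj; exact: aP.
move=> y [Hy yE]; pose t := t1 - y.
have vt1' : vsmall v 1 t1 by rewrite vsmallE // vt1.
have t0 : t != 0.
  apply/negP; rewrite subr_eq0 => /eqP t1y.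
  by move: Hy; rewrite -t1y vsmallE // vt1.
have vt : v t = 1.
  have : vsmall v 1 t by apply: vsmallB => //; apply: vsmall_le Hy.
  rewrite vsmallE // => Ht; apply/eqP; rewrite eq_le Ht andbT leNgt; apply/negP => vt.
  have : vsmall v 2 t1.
    by rewrite -(subrK y t1) vsmallD // vsmallE //; lia.
  by rewrite vsmallE // vt1.
have tA : t * A = B * t.
  apply/eqP; rewrite -subr_eq0 mulrBl mulrBr opprD addrACA -opprD.
  by rewrite yE subrr.
have ut : t \is a GRing.unit by rewrite skew_field_unit.
exists t; split=> // x; rewrite sE; first by have [] := sP x.
have [Hx xE xC] := sP x; have [Hax axE axC] := sP (alpha x).
(* The difference has residue zero and commutes with [B = t * A * t^-1], so it vanishes. *)
suff /eqP : t * s x * t^-1 - s (alpha x) = 0.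
  by rewrite subr_eq0 => /eqP <-; rewrite mulrVK.
have HJ : vsmall v 0 (t * s x * t^-1) by rewrite vsmallJ.
apply: (centr_inj B) => //.
  apply: vsmall_residue_eq => //.
  by rewrite -(alphaP t0 vt) // xE axE.
have sC u w : s u * s w = s w * s u.
  by rewrite -sE -!rmorphM mulC.
rewrite mulrBl mulrBr sC; congr (_ - _).
have BtE : B = t * A * t^-1 by rewrite tA mulrK.
rewrite BtE !mulrA !mulrVK //; congr (_ * _).
by rewrite -2!mulrA xC !mulrA.
Qed.

End Residue.

(** * Expansions in powers of [t] with coefficients in the section *)

Lemma sum_triangle (V : nmodType) (G : nat -> nat -> V) n :
  \sum_(i < n) \sum_(k < i.+1) G k (i - k)%N =
  \sum_(k < n) \sum_(l < n - k) G k l.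
Proof.
elim: n => [|n IHn]; first by rewrite !big_ord0.
rewrite big_ord_recr /= IHn [RHS]big_ord_recr /= subSnn big_ord1.
rewrite [X in _ + X]big_ord_recr /= subnn addrA -big_split /=; congr (_ + _).
by apply: eq_bigr => k _; rewrite subSn ?big_ord_recr // ltnW.
Qed.

Section Series.
Variables (K K1 : unitRingType) (v : K -> int) (res : K -> K1).
Hypotheses (sfK : skew_field K) (vP : is_dval v) (resP : is_residue_map v res).
Hypotheses (cK : vcomplete v).
Variables (alpha : K1 -> K1) (s : {rmorphism K1 -> K}) (t : K).
Hypothesis alpha_surj : forall y, exists x, alpha x = y.
Hypothesis sP : forall x, vsmall v 0 (s x) /\ res (s x) = x.
Hypotheses (t0 : t != 0) (vt : v t = 1).
Hypothesis ts : forall x, t * s x = s (alpha x) * t.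

Let ut : t \is a GRing.unit. Proof. by rewrite skew_field_unit. Qed.

Lemma section_eq0 x : s x = 0 -> x = 0.
Proof. by move=> sx; have [_ <-] := sP x; rewrite sx (residue0 resP). Qed.

Lemma aut_invK x : alpha (aut_inv alpha x) = x.
Proof. exact: (epsilon_spec (inhabits x) (fun z => alpha z = x)). Qed.

(** For negative exponents, [aut_inv] is a right inverse of [alpha], so conjugation by [t^-1]
    realises it on the image of [s]. *)
Lemma expz_section (i : int) x : t ^ i * s x = s (autz alpha i x) * t ^ i.
Proof.
case: i => n /=.
  rewrite -exprnP; elim: n => [|n IHn]; first by rewrite expr0 mulr1 mul1r.
  by rewrite exprS -mulrA IHn mulrA ts -mulrA.
have tVs y : t^-1 * s y = s (aut_inv alpha y) * t^-1.
  rewrite -[in LHS](aut_invK y); apply: (mulrI ut).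
  by rewrite mulrA mulrV // mul1r mulrA ts mulrK.
have tE : t ^ Negz n = t^-1 ^+ n.+1 by rewrite NegzE -exprnN exprVn.
rewrite tE -iterS; elim: n.+1 => [|k IHk]; first by rewrite expr0 mulr1 mul1r.
by rewrite exprS -mulrA IHk mulrA tVs -mulrA.
Qed.

(** [aut_inv] is only a chosen preimage; its value at zero is read off in [K], by conjugation and
    injectivity of [s]. *)
Lemma autz0 i : autz alpha i 0 = 0.
Proof.
have [ti0 _] := dvalXz sfK vP i t0.
have uti : t ^ i \is a GRing.unit by rewrite skew_field_unit.
apply: section_eq0; apply: (mulIr uti).
by rewrite -expz_section rmorph0 mulr0 mul0r.
Qed.

Definition series_trunc (m : int) (f : int -> K1) (n : nat) : K :=
  \sum_(k < n) s (f (m + k%:Z)) * t ^ (m + k%:Z).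

(** [x] is the sum of the series with coefficients [f]. Leaving [m] free lets the bounds of several
    series be aligned, whereas [lbound] is an arbitrary choice. *)
Definition series_rep (m : int) (f : int -> K1) (x : K) : Prop :=
  (forall j, j < m -> f j = 0) /\
  (forall n : nat, vsmall v (m + n%:Z) (x - series_trunc m f n)).

Lemma series_term (j : int) a : vsmall v j (s a * t ^ j).
Proof.
have [sa _] := sP a; rewrite -[j in vsmall _ j _]add0r; apply: vsmallM => //.
exact: vsmallXz.
Qed.

Lemma series_rep_ex m f : (forall j, j < m -> f j = 0) ->
  exists x, series_rep m f x.
Proof.
move=> fm; have [|x xP] := fast_cauchy_lim sfK vP cK (m := m) (u := series_trunc m f).
  move=> n; rewrite /series_trunc big_ord_recr /= [X in vsmall _ _ X]addrC addKr.
  exact: series_term.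
by exists x.
Qed.

Lemma series_rep_uniq m f x y : series_rep m f x -> series_rep m f y -> x = y.
Proof.
move=> [_ xP] [_ yP]; apply/eqP; rewrite -subr_eq0; apply/eqP.
apply: (vsmall_all_eq0 (v := v) (m := m)) => n.
by rewrite -(subrKA (series_trunc m f n)) vsmallD // -opprB vsmallN.
Qed.

Lemma series_truncS m f n :
  series_trunc m f n.+1 = s (f m) * t ^ m + series_trunc (m + 1) f n.
Proof.
rewrite /series_trunc big_ord_recl addr0; congr (_ + _).
by apply: eq_bigr => i _; have -> : m + (lift ord0 i)%:Z = m + 1 + i%:Z
  by rewrite lift0; lia.
Qed.

(** Terms with zero coefficient are added or dropped one index at a time. *)
Lemma series_rep_bound m m' f x : (forall j, j < m' -> f j = 0) ->
  series_rep m f x -> series_rep m' f x.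
Proof.
move=> fm' [fm xP]; split=> //.
have lower p : (forall j, j < p + 1 -> f j = 0) ->
    (forall n : nat, vsmall v (p + 1 + n%:Z) (x - series_trunc (p + 1) f n)) ->
    forall n : nat, vsmall v (p + n%:Z) (x - series_trunc p f n).
  move=> fp H [|n].
    by have := H 0%N; rewrite /series_trunc !big_ord0; apply: vsmall_le; lia.
  rewrite series_truncS fp ?rmorph0 ?mul0r ?add0r; last by lia.
  by have := H n; have -> : p + 1 + n%:Z = p + n.+1%:Z by lia.
have raise p : f p = 0 ->
    (forall n : nat, vsmall v (p + n%:Z) (x - series_trunc p f n)) ->
    forall n : nat, vsmall v (p + 1 + n%:Z) (x - series_trunc (p + 1) f n).
  move=> fp H n; have := H n.+1.
  rewrite series_truncS fp rmorph0 mul0r add0r.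
  by have -> : p + 1 + n%:Z = p + n.+1%:Z by lia.
have [lt_m|le_m] := ltP m' m.
  have -> : m' = m - (absz (m - m'))%:Z by lia.
  elim: (absz _) => [|k IHk]; first by rewrite subr0.
  have E : m - k.+1%:Z + 1 = m - k%:Z by lia.
  by apply: lower => [j jk|]; [apply: fm; lia | rewrite E].
have E : m' = m + (absz (m' - m))%:Z by lia.
rewrite E; have : m + (absz (m' - m))%:Z <= m' by lia.
elim: (absz _) => [|k IHk km]; first by rewrite addr0.
have -> : m + k.+1%:Z = m + k%:Z + 1 by lia.
apply: raise; first by apply: fm'; lia.
by apply: IHk; lia.
Qed.

(** The lowest coefficient is a residue of [x] times a power of [t]; if [x] has order at least [N],
    the coefficients vanish one after the other from [m] up to [N]. *)
Lemma series_rep_vsmall m N f x : series_rep m f x ->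
  vsmall v N x <-> forall j, j < N -> f j = 0.
Proof.
move=> rx; split=> [Nx|fN]; last first.
  have [_ H] := series_rep_bound fN rx.
  by have := H 0%N; rewrite addr0 /series_trunc big_ord0 subr0.
have [fm _] := rx.
have step k : m + k%:Z <= N -> forall j, j < m + k%:Z -> f j = 0.
  elim: k => [|k IHk] kN j jk; first by apply: fm; lia.
  have {}IHk : forall j, j < m + k%:Z -> f j = 0 by apply: IHk; lia.
  have [->|jk'] : j = m + k%:Z \/ j < m + k%:Z by lia.
    have [_ /(_ 1%N)] := series_rep_bound IHk rx.
    rewrite series_truncS /series_trunc big_ord0 addr0; set p := m + k%:Z => H.
    have Np : vsmall v (p + 1) x by apply: vsmall_le Nx; lia.
    (* The term of degree [p] is a difference of two elements of order above [p]; multiplied by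
       [t ^ (- p)], it leaves [s (f p)] in the maximal ideal. *)
    have := vsmallB sfK vP Np H; rewrite subKr => H'.
    have := vsmallM sfK vP H' (vsmallXz sfK vP (- p) t0 vt).
    rewrite -mulrA -exprzDr // subrr expr0z mulr1 addrAC subrr add0r.
    have [sO sE] := sP (f p).
    by rewrite -(residue_eq0 resP) // sE => /eqP.
  exact: IHk.
move=> j jN; have [jm|mj] := ltP j m; first exact: fm.
by apply: (step (absz (N - m))); lia.
Qed.

Lemma series_repD m f g x y : series_rep m f x -> series_rep m g y ->
  series_rep m (ls_add f g) (x + y).
Proof.
move=> [fm xP] [gm yP]; split=> [j jm|n]; first by rewrite /ls_add fm ?gm ?addr0.
have -> : series_trunc m (ls_add f g) n = series_trunc m f n + series_trunc m g n.
  by rewrite -big_split; apply: eq_bigr => k _; rewrite rmorphD mulrDl.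
by rewrite opprD addrACA vsmallD.
Qed.

Lemma series_repB m f g x y : series_rep m f x -> series_rep m g y ->
  series_rep m (fun j => f j - g j) (x - y).
Proof.
move=> [fm xP] [gm yP]; split=> [j jm|n]; first by rewrite fm ?gm ?subr0.
have -> : series_trunc m (fun j => f j - g j) n =
    series_trunc m f n - series_trunc m g n.
  by rewrite -sumrB; apply: eq_bigr => k _; rewrite rmorphB mulrBl.
by rewrite opprD addrACA -opprD vsmallB.
Qed.

Lemma series_rep_inj m m' f g x :
  series_rep m f x -> series_rep m' g x -> f = g.
Proof.
move=> rf rg; have [fm _] := rf; have [gm _] := rg.
pose p := Order.min m m'.
have rf' : series_rep p f x by apply: series_rep_bound rf => j jp; apply: fm; lia.
have rg' : series_rep p g x by apply: series_rep_bound rg => j jp; apply: gm; lia.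
apply: functional_extensionality => j; apply/eqP; rewrite -subr_eq0; apply/eqP.
have [H _] := series_rep_vsmall (j + 1) (series_repB rf' rg').
by apply: (H _ j); rewrite ?subrr ?vsmall0 //; lia.
Qed.

(** Coefficients are read greedily: [c] is the leading coefficient of the remainder [r], and
    subtracting its term raises the order by one. *)
Lemma series_rep_surj x : exists m f, series_rep m f x.
Proof.
have [m mx] : exists m, vsmall v m x.
  by exists (v x); rewrite /vsmall lexx orbT.
pose c (n : nat) y := res (y * t ^ (- (m + n%:Z))).
pose fix r (n : nat) : K := if n is k.+1 then
  r k - s (c k (r k)) * t ^ (m + k%:Z) else x.
pose f j := if m <= j then c (absz (j - m)) (r (absz (j - m))) else 0.
have fE (n : nat) : f (m + n%:Z) = c n (r n).
  have E : absz (m + n%:Z - m)%R = n by lia.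
  by rewrite /f E; case: ifP => //; lia.
have rE n : x - series_trunc m f n = r n.
  elim: n => [|n IHn] /=; first by rewrite /series_trunc big_ord0 subr0.
  by rewrite /series_trunc big_ord_recr /= opprD addrA IHn fE.
exists m, f; split=> [j jm|n].
  by rewrite /f; case: ifP => //; lia.
rewrite rE; elim: n => [|n IHn] /=; first by rewrite addr0.
set p := m + n%:Z in IHn *.
have -> : m + n.+1%:Z = 1 + p by rewrite /p; lia.
have Hr := vsmall_divXz sfK vP t0 vt IHn.
have [sO sE] := sP (c n (r n)).
have -> : r n - s (c n (r n)) * t ^ p = (r n * t ^ (- p) - s (c n (r n))) * t ^ p.
  by rewrite mulrBl -mulrA -exprzDr // addNr expr0z mulr1.
apply: vsmallM => //; last exact: vsmallXz.
exact: (vsmall_residue_eq sfK vP resP).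
Qed.

Lemma series_rep1 : series_rep 0 (@ls_one K1) 1.
Proof.
split=> [j j0|n]; first by rewrite /ls_one; case: eqP => //; lia.
case: n => [|n].
  by rewrite addr0 /series_trunc big_ord0 subr0; apply: vring1.
rewrite /series_trunc big_ord_recl /ls_one addr0 eqxx rmorph1 expr0z mulr1.
rewrite big1 ?addr0 ?subrr ?vsmall0 // => i _.
by rewrite lift0; case: eqP => [|_]; [lia | rewrite rmorph0 mul0r].
Qed.

(* [ls_mul] with arbitrary lower bounds in place of the chosen ones. *)
Definition ls_conv (m m' : int) (f g : int -> K1) : int -> K1 := fun n =>
  \sum_(k < (absz (n - m - m')%R).+1)
     f (m + k%:Z) * autz alpha (m + k%:Z) (g (n - (m + k%:Z))).

Lemma series_repM m m' f g x y : series_rep m f x -> series_rep m' g y ->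
  series_rep (m + m') (ls_conv m m' f g) (x * y).
Proof.
move=> rf rg; have [fm xP] := rf; have [gm yP] := rg; split=> [j jm|n].
  rewrite /ls_conv big1 // => k _.
  by rewrite gm ?autz0 ?mulr0 //; lia.
set X := series_trunc m f n; set Y := series_trunc m' g n.
have Hy : vsmall v m' y by apply/(series_rep_vsmall _ rg).
have HX : vsmall v m X.
  by apply: vsmall_sum => // k _; apply: vsmall_le (series_term _ _); lia.
pose G (k l : nat) := s (f (m + k%:Z)) * t ^ (m + k%:Z) *
  (s (g (m' + l%:Z)) * t ^ (m' + l%:Z)).
have GE k l : G k l = s (f (m + k%:Z) * autz alpha (m + k%:Z) (g (m' + l%:Z))) *
    t ^ (m + m' + (k + l)%:Z).
  have -> : m + m' + (k + l)%:Z = (m + k%:Z) + (m' + l%:Z) by lia.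
  rewrite (exprzDr ut (m + k%:Z)) rmorphM /G -mulrA [t ^ _ * (s _ * _)]mulrA.
  by rewrite expz_section !mulrA.
have XY : X * Y = \sum_(k < n) \sum_(l < n) G k l.
  by rewrite mulr_suml; apply: eq_bigr => k _; rewrite mulr_sumr.
(* The truncated product runs over the antidiagonals [k + l = i] with [i < n]; [sum_triangle]
   regroups them into rows. *)
have T : series_trunc (m + m') (ls_conv m m' f g) n =
    \sum_(k < n) \sum_(l < n - k) G k l.
  rewrite -sum_triangle; apply: eq_bigr => i _; rewrite /ls_conv rmorph_sum mulr_suml.
  have -> : absz (m + m' + i%:Z - m - m')%R = i by lia.
  apply: eq_bigr => k _; rewrite GE.
  have ki : (k <= i)%N by rewrite -ltnS.
  have -> : (k + (i - k))%N = i by rewrite subnKC.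
  by have -> : m + m' + i%:Z - (m + k%:Z) = m' + (i - k)%:Z by lia.
(* Truncating the factors costs only order [m + m' + n], and [X * Y] exceeds the truncated product
   by the terms with [k + l] at least [n]. *)
have -> : x * y - series_trunc (m + m') (ls_conv m m' f g) n =
    (x - X) * y + X * (y - Y) +
    (X * Y - series_trunc (m + m') (ls_conv m m' f g) n).
  by rewrite mulrBl mulrBr !subrKA.
apply: vsmallD => //; first apply: vsmallD => //.
- by rewrite addrAC; apply: vsmallM.
- by rewrite -addrA; apply: vsmallM.
rewrite XY T -sumrB; apply: vsmall_sum => // k _.
have kn : (n - k + k)%N = n by rewrite subnK // ltnW.
have E a b : \sum_(l < a + b) G k l = \sum_(l < a) G k l + \sum_(l < b) G k (a + l)%N.
  by rewrite big_split_ord.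
have {E} := E (n - k)%N k; rewrite kn => ->.
rewrite [X in vsmall _ _ X]addrAC subrr add0r.
apply: vsmall_sum => // l _; rewrite GE; apply: vsmall_le (series_term _ _).
by have := ltn_ord k; lia.
Qed.

Lemma series_rep_residue m f x : series_rep m f x -> vsmall v 0 x -> res x = f 0.
Proof.
move=> rx x0; have f0 := (series_rep_vsmall 0 rx).1 x0.
have [_ /(_ 1%N)] := series_rep_bound f0 rx.
rewrite series_truncS /series_trunc big_ord0 addr0 expr0z mulr1 add0r => H.
have [sO sE] := sP (f 0); rewrite -[RHS]sE; apply/eqP; rewrite -subr_eq0.
by rewrite -(residueB sfK vP resP) // (residue_eq0 resP) // vsmallB.
Qed.

Theorem iso_skew_laurent_of_section (v1 : K1 -> int) :
  iso_skew_laurent v res v1 alpha.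
Proof.
pose phi f := epsilon (inhabits 0) (series_rep (lbound f) f).
have lbP (f : int -> K1) : lbounded f -> forall j, j < lbound f -> f j = 0.
  by move=> fb; apply: (epsilon_spec (inhabits 0) (fun m => forall j, j < m -> f j = 0)).
have phiP f : lbounded f -> series_rep (lbound f) f (phi f).
  by move=> fb; apply: epsilon_spec; apply/series_rep_ex/lbP.
(* [phi] sums from the chosen [lbound]; this frees the remaining checks from that choice. *)
have phiE m f x : series_rep m f x -> phi f = x.
  move=> rx; have fb : lbounded f by exists m; case: rx.
  have rx' := series_rep_bound (lbP f fb) rx.
  exact: series_rep_uniq (phiP f fb) rx'.
exists phi; split; [|split; [|split; [|split; [|split; [|split; [|split]]]]]].
- move=> f g fb gb E; have := phiP g gb; rewrite -E => rg.
  exact: series_rep_inj (phiP f fb) rg.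
- move=> x; have [m [f rf]] := series_rep_surj x.
  by exists f; [exists m; case: rf | apply: phiE rf].
- move=> f g fb gb; pose p := Order.min (lbound f) (lbound g).
  apply: (phiE p); apply: series_repD.
    by apply: series_rep_bound (phiP f fb) => j; rewrite lt_min => /andP[/(lbP f fb)].
  by apply: series_rep_bound (phiP g gb) => j; rewrite lt_min => /andP[_ /(lbP g gb)].
- move=> f g fb gb; apply: phiE; exact: series_repM (phiP f fb) (phiP g gb).
- exact: phiE series_rep1.
- by move=> f fb; apply: (series_rep_vsmall 0 (phiP f fb)).
- move=> f fb; split=> [/(series_rep_vsmall 1 (phiP f fb)) f1 j j0|f1].
    by apply: f1; lia.
  by apply/(series_rep_vsmall 1 (phiP f fb)) => j j0; apply: f1; lia.
exists id; split=> // f fb f0; apply: series_rep_residue (phiP f fb) _.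
by apply/(series_rep_vsmall 0 (phiP f fb)).
Qed.

End Series.

Lemma inj_surj_bij (A B : Type) (f : A -> B) :
  injective f -> (forall y, exists x, f x = y) -> bijective f.
Proof.
move=> fI fS; pose g y := sval (constructive_indefinite_description _ (fS y)).
have gK : cancel g f by move=> y; apply: (svalP (constructive_indefinite_description _ (fS y))).
by exists g => // x; apply: fI; rewrite gK.
Qed.

(** * Transport of expansions along an isomorphism of residue fields *)

Section Transport.
Variables (K K1 : unitRingType) (v : K -> int) (res : K -> K1).
Hypotheses (sfK : skew_field K) (vP : is_dval v) (resP : is_residue_map v res).
Hypotheses (cK : vcomplete v).
Variables (alpha : K1 -> K1) (s : {rmorphism K1 -> K}) (t : K).
Hypothesis alpha_surj : forall y, exists x, alpha x = y.
Hypothesis sP : forall x, vsmall v 0 (s x) /\ res (s x) = x.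
Hypotheses (t0 : t != 0) (vt : v t = 1).
Hypothesis ts : forall x, t * s x = s (alpha x) * t.

Variables (K' K1' : unitRingType) (v' : K' -> int) (res' : K' -> K1').
Hypotheses (sfK' : skew_field K') (vP' : is_dval v') (resP' : is_residue_map v' res').
Hypotheses (cK' : vcomplete v').
Variables (alpha' : K1' -> K1') (s' : {rmorphism K1' -> K'}) (t' : K').
Hypothesis alpha_surj' : forall y, exists x, alpha' x = y.
Hypothesis alpha_inj' : injective alpha'.
Hypothesis sP' : forall x, vsmall v' 0 (s' x) /\ res' (s' x) = x.
Hypotheses (t0' : t' != 0) (vt' : v' t' = 1).
Hypothesis ts' : forall x, t' * s' x = s' (alpha' x) * t'.

Variable f : {rmorphism K1 -> K1'}.
Hypothesis f_inj : injective f.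
Hypothesis f_surj : forall y, exists x, f x = y.
Hypothesis f_alpha : forall a, f (alpha a) = alpha' (f a).

(** For negative [i], two chosen preimages must be identified, which injectivity of [alpha']
    does. *)
Lemma autz_intertwine i x : f (autz alpha i x) = autz alpha' i (f x).
Proof.
case: i => n /=; first by elim: n => //= n <-.
have inv y : f (aut_inv alpha y) = aut_inv alpha' (f y).
  by apply: alpha_inj'; rewrite -f_alpha !aut_invK.
by rewrite inv; congr (aut_inv alpha' _); elim: n => //= n <-.
Qed.

Lemma ls_conv_intertwine m m' g h :
  f \o ls_conv alpha m m' g h = ls_conv alpha' m m' (f \o g) (f \o h).
Proof.
apply: functional_extensionality => j; rewrite /= /ls_conv rmorph_sum.
by apply: eq_bigr => k _; rewrite rmorphM /= autz_intertwine.
Qed.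

Let rep := series_rep v s t.
Let rep' := series_rep v' s' t'.

(** In effect the map sending [s a] to [s' (f a)] and [t] to [t'], given coefficientwise. *)
Definition transport (x : K) : K' := epsilon (inhabits 0)
  (fun y => exists m h, rep m h x /\ rep' m (f \o h) y).

Lemma transportE m h x y : rep m h x -> rep' m (f \o h) y -> transport x = y.
Proof.
move=> rx ry; have : exists z, exists m h, rep m h x /\ rep' m (f \o h) z.
  by exists y, m, h.
move/(epsilon_spec (inhabits 0)); rewrite -/(transport x) => -[m1 [h1 [rx1 ry1]]].
have hE := series_rep_inj sfK vP resP sP t0 vt rx1 rx.
rewrite hE in ry1; have [fm _] := ry.
exact: (series_rep_uniq sfK' vP' (series_rep_bound sfK' t0' vt' fm ry1) ry).
Qed.

Lemma transportP m h x : rep m h x -> rep' m (f \o h) (transport x).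
Proof.
move=> rx; have [hm _] := rx.
have [|y ry] := series_rep_ex sfK' vP' cK' sP' t0' vt' (m := m) (f := f \o h).
  by move=> j jm /=; rewrite hm // rmorph0.
by rewrite (transportE rx ry).
Qed.

(** Orders are read from vanishing coefficients, and an injective [f] neither creates nor destroys
    zeros. *)
Lemma transport_vsmall N x : vsmall v' N (transport x) = vsmall v N x.
Proof.
have [m [h rx]] := series_rep_surj sfK vP resP sP t0 vt x.
have ry := transportP rx; apply/idP/idP.
  move/(series_rep_vsmall sfK' vP' resP' sP' t0' vt' N ry) => H.
  apply/(series_rep_vsmall sfK vP resP sP t0 vt N rx) => j jN.
  by apply: f_inj; rewrite rmorph0; apply: (H j).
move/(series_rep_vsmall sfK vP resP sP t0 vt N rx) => H.
apply/(series_rep_vsmall sfK' vP' resP' sP' t0' vt' N ry) => j jN.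
by rewrite /= H // rmorph0.
Qed.

Theorem exists_transport : exists Phi : {rmorphism K -> K'},
  [/\ bijective Phi, forall N x, vsmall v' N (Phi x) = vsmall v N x &
      forall x, vsmall v 0 x -> f (res x) = res' (Phi x)].
Proof.
have repS := series_rep_surj sfK vP resP sP t0 vt.
have bound m p h x : rep m h x -> rep (Order.min p m) h x.
  move=> rx; apply: (series_rep_bound sfK t0 vt _ rx) => j; have [hm _] := rx.
  by rewrite lt_min => /andP[_ /hm].
have [] := @exists_rmorphism K K' transport.
- move=> x y; have [m [h rx]] := repS x; have [m' [h' ry]] := repS y.
  have rx' : rep (Order.min m m') h x by rewrite minC; apply: bound.
  have ry' := bound _ m _ _ ry.
  apply: transportE; first exact: (series_repB sfK vP rx' ry').
  have -> : f \o (fun j => h j - h' j) = fun j => (f \o h) j - (f \o h') j.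
    by apply: functional_extensionality => j /=; rewrite rmorphB.
  exact: (series_repB sfK' vP' (transportP rx') (transportP ry')).
- apply: transportE; first exact: (series_rep1 sfK vP s t0 vt).
  have -> : f \o @ls_one K1 = @ls_one K1'.
    apply: functional_extensionality => j; rewrite /ls_one /=.
    by case: eqP; rewrite ?rmorph1 ?rmorph0.
  exact: (series_rep1 sfK' vP' s' t0' vt').
- move=> x y; have [m [h rx]] := repS x; have [m' [h' ry]] := repS y.
  apply: transportE; first exact: (series_repM sfK vP resP alpha_surj sP t0 vt ts rx ry).
  rewrite ls_conv_intertwine.
  exact: (series_repM sfK' vP' resP' alpha_surj' sP' t0' vt' ts' (transportP rx) (transportP ry)).
move=> Phi PhiE; exists Phi; split.
- apply: inj_surj_bij => [x y xy|y].
    (* The difference has image zero, so by preservation of orders it has every order. *)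
    apply/eqP; rewrite -subr_eq0; apply/eqP; apply: (vsmall_all_eq0 (v := v) (m := 0)) => n.
    by rewrite -transport_vsmall -PhiE rmorphB /= xy subrr vsmall0.
  have [m [h ry]] := series_rep_surj sfK' vP' resP' sP' t0' vt' y.
  have [g fg gf] := inj_surj_bij f_inj f_surj.
  have hE : f \o (g \o h) = h by apply: functional_extensionality => j /=.
  have [|x rx] := series_rep_ex sfK vP cK sP t0 vt (m := m) (f := g \o h).
    have [hm _] := ry; move=> j jm /=; apply: f_inj.
    by rewrite gf hm // rmorph0.
  by exists x; rewrite PhiE; apply: transportE rx _; rewrite hE.
- by move=> N x; rewrite PhiE transport_vsmall.
move=> x Hx; have [m [h rx]] := repS x.
rewrite (series_rep_residue sfK vP resP sP t0 vt rx Hx) PhiE.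
rewrite (series_rep_residue sfK' vP' resP' sP' t0' vt' (transportP rx)) //.
by rewrite transport_vsmall.
Qed.

End Transport.

(* An isomorphism of valuation rings transports conjugation by a prime element to conjugation by a prime element. *)
Lemma iso_residue_rmorphism (K K1 : unitRingType) (v : K -> int) (res : K -> K1)
    (alpha : K1 -> K1) (K' K1' : unitRingType) (v' : K' -> int)
    (res' : K' -> K1') (alpha' : K1' -> K1') (phi : {rmorphism K -> K'})
    (g : K1 -> K1') :
  skew_field K -> is_dval v -> is_residue_map v res -> canonical_aut v res alpha ->
  skew_field K' -> is_dval v' -> is_residue_map v' res' -> canonical_aut v' res' alpha' ->
  bijective phi -> (forall x, vring v' (phi x) = vring v x) ->
  (forall x, vmax v' (phi x) = vmax v x) ->
  (forall x, vring v x -> g (res x) = res' (phi x)) ->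
  exists f : {rmorphism K1 -> K1'},
    bijective f /\ forall a, f (alpha a) = alpha' (f a).
Proof.
move=> sfK vP resP alP sfK' vP' resP' alP' [psi psiK phiK] ringE maxE gE.
have phiI : injective phi := can_inj psiK.
have phiS y : exists x, phi x = y by exists (psi y).
have ring' x : vsmall v 0 x -> vsmall v' 0 (phi x).
  by move=> Hx; rewrite [vsmall _ _ _]ringE.
have gB : {morph g : x y / x - y}.
  move=> x y; have [x' Hx <-] := res_surj resP x; have [y' Hy <-] := res_surj resP y.
  rewrite -(residueB sfK vP resP) // !gE //; last exact: vsmallB.
  by rewrite rmorphB (residueB sfK' vP' resP') // ring'.
have [] := exists_rmorphism gB.
- by rewrite -(res_one resP) gE ?rmorph1 ?(res_one resP') //; apply: vring1.
- move=> x y; have [x' Hx <-] := res_surj resP x; have [y' Hy <-] := res_surj resP y.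
  rewrite -(residueM resP) // !gE //; last exact: vringM.
  by rewrite rmorphM (residueM resP') // ring'.
move=> f fE; exists f; rewrite fE; split.
  apply: inj_surj_bij => [x y xy|y].
    apply/eqP; rewrite -subr_eq0; have [z Hz zE] := res_surj resP (x - y).
    rewrite -zE (res_ker resP) // -maxE -(res_ker resP') ?ringE // -gE // zE.
    by rewrite gB xy subrr.
  have [y' Hy <-] := res_surj resP' y; have [x xE] := phiS y'.
  by exists (res x); rewrite gE ?xE // -ringE xE.
have [t [t0 vt]] := dval_surj vP 1.
have ut : t \is a GRing.unit by rewrite skew_field_unit.
have pt0 : phi t != 0 by rewrite -(rmorph0 phi) (inj_eq phiI).
(* [v' \o phi] is a discrete valuation on [K] whose ring contains that of [v]; the two agree, so
   [phi t] is prime. *)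
have vpt : v' (phi t) = 1.
  rewrite -vt; apply: (dval_eq_of_vring_sub sfK vP (dval_comp vP' phiI phiS)) => // x Hx.
  by have := ring' x Hx; rewrite /vsmall -(rmorph0 phi) (inj_eq phiI).
move=> a; have [x Hx <-] := res_surj resP a.
rewrite (alP t t0 vt) // !gE ?(alP' _ pt0 vpt) ?ringE //; last first.
  by rewrite [vring _ _]vsmallJ.
by rewrite !rmorphM rmorphV.
Qed.

(** * Nontorsion canonical automorphisms: splitting and classification *)

Lemma two_dim_local_section (K K1 : unitRingType) (v : K -> int) (res : K -> K1)
    (v1 : K1 -> int) (alpha : K1 -> K1) :
  two_dim_local v res v1 -> commutative_ring K1 -> canonical_aut v res alpha ->
  aut_nontorsion alpha ->
  exists (s : {rmorphism K1 -> K}) (t : K),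
    [/\ forall x, vsmall v 0 (s x) /\ res (s x) = x, t != 0, v t = 1 &
        forall x, t * s x = s (alpha x) * t].
Proof.
move=> [[sfK vP cK] resP [sfK1 v1P cK1]] mulC alP alN.
apply: (exists_equivariant_section sfK vP resP alP cK sfK1 mulC).
have aI := canonical_aut_inj sfK vP resP alP.
have aS := canonical_aut_surj sfK vP resP alP.
have [al alE] := canonical_aut_rmorphism sfK vP resP alP.
rewrite -alE in aI aS alN *.
(* [v1 \o al] is a second discrete valuation on the complete field [K1], so uniqueness makes [al] an
   isometry, as the Baire argument requires. *)
have al_iso := cdv_unique sfK1 v1P (dval_comp v1P aI aS) cK1 mulC.
exact: (exists_aperiodic sfK1 v1P cK1 al_iso alN).
Qed.

Theorem theorem8p2 :
  (forall (K2 K1 : unitRingType) (v2 : K2 -> int) (res : K2 -> K1)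
          (v1 : K1 -> int) (alpha : K1 -> K1),
     two_dim_local v2 res v1 ->
     commutative_ring K1 ->
     canonical_aut v2 res alpha ->
     aut_nontorsion alpha ->
     [/\ [pchar K2] =i [pchar K1],
         splits v2 res &
         iso_skew_laurent v2 res v1 alpha])
  /\
  (forall (K2 K1 : unitRingType) (v2 : K2 -> int) (res : K2 -> K1)
          (v1 : K1 -> int) (alpha : K1 -> K1)
          (K2' K1' : unitRingType) (v2' : K2' -> int) (res' : K2' -> K1')
          (v1' : K1' -> int) (alpha' : K1' -> K1'),
     two_dim_local v2 res v1 -> commutative_ring K1 ->
     canonical_aut v2 res alpha -> aut_nontorsion alpha ->
     two_dim_local v2' res' v1' -> commutative_ring K1' ->
     canonical_aut v2' res' alpha' -> aut_nontorsion alpha' ->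
     (tdl_iso v2 res v1 v2' res' v1' <->
      exists f : {rmorphism K1 -> K1'},
        bijective f /\ forall a, f (alpha a) = alpha' (f a))).
Proof.
split=> [K2 K1 v2 res v1 alpha loc mulC alP alN|].
  have [s [t [sP t0 vt ts]]] := two_dim_local_section loc mulC alP alN.
  have [[sfK vP cK] resP _] := loc.
  split; last first.
  - apply: (iso_skew_laurent_of_section sfK vP resP cK _ sP t0 vt ts).
    exact: canonical_aut_surj alP.
  - by exists s.
  (* [s] is injective and maps each [p%:R] of [K1] to that of [K2], so the characteristics agree. *)
  move=> p; rewrite !inE; congr (_ && _); rewrite -(rmorph_nat s).
  apply/eqP/eqP => [/(section_eq0 resP sP) //|->]; exact: rmorph0.
move=> K K1 v res v1 alpha K' K1' v' res' v1' alpha' loc mulC alP alN loc' mulC' alP' alN'.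
have [[sfK vP cK] resP [sfK1 v1P cK1]] := loc.
have [[sfK' vP' cK'] resP' [sfK1' v1P' cK1']] := loc'.
split=> [[phi [phiB ringE maxE [g [gE _ _]]]]|[f [fB f_alpha]]].
  exact: (iso_residue_rmorphism sfK vP resP alP sfK' vP' resP' alP' phiB ringE maxE gE).
have [s [t [sP t0 vt ts]]] := two_dim_local_section loc mulC alP alN.
have [s' [t' [sP' t0' vt' ts']]] := two_dim_local_section loc' mulC' alP' alN'.
have fI := bij_inj fB.
have fS y : exists x, f x = y by case: fB => h _ fh; exists (h y).
have aS := canonical_aut_surj sfK vP resP alP.
have aS' := canonical_aut_surj sfK' vP' resP' alP'.
have aI' := canonical_aut_inj sfK' vP' resP' alP'.
have [Phi [PhiB PhiV PhiR]] := exists_transport sfK vP resP cK aS sP t0 vt ts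
  sfK' vP' resP' cK' aS' aI' sP' t0' vt' ts' fI fS f_alpha.
(* An abstract field isomorphism [f] respects [v1] and [v1'], again by uniqueness of the
   valuation. *)
have fv N y : vsmall v1' N (f y) = vsmall v1 N y.
  have := cdv_unique sfK1 v1P (dval_comp v1P' fI fS) cK1 mulC (x := y).
  rewrite /vsmall -(rmorph0 f) (inj_eq fI); case: eqP => //= _ -> //.
exists Phi; split=> //; first by move=> x; apply: (PhiV 0).
  by move=> x; apply: (PhiV 1).
exists f; split=> [x Hx|y|y]; [exact: PhiR | exact: (fv 0) | exact: (fv 1)].
Qed.
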